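(* Let $n,m$ be positive integers, and let $A_{ij}$ $(i\in[n], j\in[m])$ be $mn$ subsets of the simplex $\Delta^{n-1}$, either all open or all closed (in $\Delta^{n-1}$). Suppose that $A_{ij}$ does not intersect $\partial_i\Delta^{n-1}$ for all $i\in[n]$, $j\in[m]$, and that for every $j\in[m]$ the family $\mathcal A_j=\{A_{ij}\}_{i=1}^n$ is a covering of $\Delta^{n-1}$. Let $a_1,\ldots,a_n$ be positive integers with $\sum_{i=1}^n a_i=m$. Then there exists a map $\sigma:[m]\to[n]$ such that $|\sigma^{-1}(i)|=a_i$ for all $i\in[n]$ and $$\bigcap_{j=1}^m A_{\sigma(j)j}\neq\emptyset.$$
   Context: $[n]=\{1,2,\ldots,n\}$. $\Delta^{d}$ denotes the $d$-dimensional geometric simplex, whose points are given by barycentric coordinates $(t_1,\ldots,t_{d+1})$ with all $t_i\ge 0$ and $\sum_{i=1}^{d+1}t_i=1$. For $i\in[d+1]$, $\partial_i\Delta^d=\{(t_1,\ldots,t_{d+1})\in\Delta^d: t_i=0\}$ is the $i$-th facet. *)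

(* Defs.v *)
From HB Require Import structures.
From mathcomp Require Import all_boot all_order all_algebra.
From mathcomp Require Import all_classical all_reals all_analysis.
Set Implicit Arguments.
Unset Strict Implicit.
Unset Printing Implicit Defensive.
Import Order.TTheory GRing.Theory Num.Theory.
Import numFieldNormedType.Exports.
Local Open Scope classical_set_scope.
Local Open Scope ring_scope.

(* The (n-1)-dimensional geometric simplex: n is the number of barycentric
   coordinates, and the coordinates t_1, ..., t_n are indexed by 'I_n from 0. *)
Definition simplex (R : realType) (n : nat) : set 'rV[R]_n :=
  [set t : 'rV[R]_n | (forall i, 0 <= t ord0 i) /\ \sum_(i < n) t ord0 i = 1].
Arguments simplex : clear implicits.

Definition facet (R : realType) (n : nat) (i : 'I_n) : set 'rV[R]_n :=
  [set t : 'rV[R]_n | simplex R n t /\ t ord0 i = 0].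
Arguments facet : clear implicits.

(* For A contained in D (cf. open_subspaceP and closed_subspaceP), these say
   that A is the trace on D of an open, resp. closed, set of T. *)
Definition open_in (T : topologicalType) (D A : set T) : Prop :=
  open (A : set (subspace D)).

Definition closed_in (T : topologicalType) (D A : set T) : Prop :=
  closed (A : set (subspace D)).

(* Main.v *)
(* For finitely many points carrying n linear orders, call (S, C) dominant if every point is
   below all of S for some order in C.  Scarf's lemma (a parity count on pairs (S, C) with
   #|S| = #|C|) gives, for any labelling of the points by the orders, a dominant pair with C
   contained in the labels of S.  On a fine grid of the simplex, ordered by each barycentric
   coordinate, dominance forces S to be small and close to the face spanned by C, so by
   compactness any labelling c of the simplex has a point x lying in the closure of c^-1(i)
   whenever x_i > 0.

   Given a partition of unity (w_ij)_i for each j, with w_ij vanishing on the i-th facet, label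
   t by some i with sum_j w_ij(t) <= a_i.  Then sum_j w_ij(x) <= a_i for all i, and Hall's
   theorem with capacities a_i picks sigma with w_(sigma j, j)(x) > 0 for all j.  For open A_ij
   take w_ij supported in A_ij; for closed A_ij take it supported in an e-neighbourhood and
   let e tend to 0. *)
Require Import Defs.
From HB Require Import structures.
From mathcomp Require Import all_boot all_order all_algebra zify.

Set Implicit Arguments.
Unset Strict Implicit.
Unset Printing Implicit Defensive.

Local Open Scope nat_scope.

(** * Dominant sets and the parity count *)

Lemma even_sum (J : finType) (P : pred J) (F : J -> nat) :
  (forall j, P j -> ~~ odd (F j)) -> ~~ odd (\sum_(j | P j) F j).
Proof.
move=> evF; apply: (big_ind (fun s => ~~ odd s)) => // s t.
by rewrite oddD => /negPf-> /negPf->.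
Qed.

Section Scarf.
Variables (X I : finType).

Lemma card_imset_setC1 (c : X -> I) (S : {set X}) (i : I) :
  c @: S = [set~ i] -> #|S| < #|I| -> {in S &, injective c}.
Proof.
move=> cS ltSI; apply/imset_injP; rewrite eqn_leq leq_imset_card cS cardsC1.
by lia.
Qed.

Lemma odd_almost_rainbow (c : X -> I) (S : {set X}) (i0 : I) :
  #|S| = #|I| ->
  odd #|[set x in S | c @: (S :\ x) == [set~ i0]]| = (c @: S == setT).
Proof.
move=> cardS; have cardSD x : x \in S -> #|S :\ x| < #|I|.
  by move=> xS; rewrite -cardS (cardsD1 x S) xS.
have [cST|cSNT] := eqVneq.
  have injc : {in S &, injective c} by apply/imset_injP; rewrite cST cardsT cardS.
  have /imsetP[x0 x0S i0E] : i0 \in c @: S by rewrite cST inE.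
  suff -> : [set x in S | c @: (S :\ x) == [set~ i0]] = [set x0] by rewrite cards1.
  apply/setP => x; rewrite !inE; apply/idP/eqP => [/andP[xS /eqP cx]|->].
    apply/eqP; apply: contraT => xx0; have : i0 \in c @: (S :\ x).
      by apply/imsetP; exists x0 => //; rewrite !inE x0S eq_sym xx0.
    by rewrite cx !inE eqxx.
  rewrite x0S; apply/eqP/setP => i; rewrite !inE; apply/imsetP/idP.
    move=> [y]; rewrite !inE => /andP[yx0 yS] ->; apply: contra yx0 => /eqP.
    by rewrite i0E => /injc -> //.
  move=> ii0; have /imsetP[y yS iE] : i \in c @: S by rewrite cST inE.
  by exists y => //; rewrite !inE yS andbT; apply: contra ii0 => /eqP yx0; rewrite iE yx0 i0E.
have [->|[x1]] := set_0Vmem [set x in S | c @: (S :\ x) == [set~ i0]].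
  by rewrite cards0.
rewrite inE => /andP[x1S /eqP cx1].
have inj1 := card_imset_setC1 cx1 (cardSD _ x1S).
have cx1i0 : c x1 != i0.
  apply: contra cSNT => /eqP cx1E; rewrite -(setD1K x1S) imsetU1 cx1 cx1E.
  by apply/eqP/setP => i; rewrite !inE orbN.
have /imsetP[x2 x2S cx12] : c x1 \in c @: (S :\ x1) by rewrite cx1 !inE.
move: (x2S); rewrite !inE => /andP[x21 x2S'].
suff -> : [set x in S | c @: (S :\ x) == [set~ i0]] = [set x1; x2].
  by rewrite cards2 eq_sym x21.
apply/setP => y; rewrite !inE; apply/idP/idP.
  move: y => x /andP[xS /eqP cx]; apply: contraT; rewrite negb_or => /andP[xx1 xx2].
  have injx := card_imset_setC1 cx (cardSD _ xS).
  move/eqP: x21; case; apply: injx => //; rewrite !inE ?x1S ?x2S' ?andbT 1?eq_sym //.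
move=> /orP[] /eqP->; first by rewrite x1S cx1 eqxx.
rewrite x2S' -cx1; apply/eqP/setP => i; apply/imsetP/imsetP => -[x].
  rewrite !inE => /andP[xx2 xS] ->; have [->|xx1] := eqVneq x x1.
    by exists x2 => //; rewrite !inE x21.
  by exists x => //; rewrite !inE xx1.
rewrite !inE => /andP[xx1 xS] ->; have [->|xx2] := eqVneq x x2.
  by exists x1 => //; rewrite !inE x1S eq_sym x21.
by exists x => //; rewrite !inE xx2.
Qed.

Variable k : I -> X -> nat.
Hypothesis k_inj : forall i, injective (k i).

Definition dominant (S : {set X}) :=
  [forall y, exists i, forall x in S, k i y <= k i x].

Lemma dominantP (S : {set X}) :
  reflect (forall y, exists i, forall x, x \in S -> k i y <= k i x) (dominant S).
Proof.
apply: (iffP forallP) => dS y.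
  by have /existsP[i /forall_inP] := dS y; exists i.
by have [i ki] := dS y; apply/existsP; exists i; apply/forall_inP.
Qed.

Lemma dominantS (S S' : {set X}) : S \subset S' -> dominant S' -> dominant S.
Proof.
move=> /subsetP sSS' /dominantP dS'; apply/dominantP => y.
by have [i ki] := dS' y; exists i => x /sSS'/ki.
Qed.

(** Pivoting. By dominance every point of [S] is the minimum [mi i] of some order, and [S] has one
    point less than there are orders, so exactly two orders [a], [b] share their minimum. A new
    vertex takes over as minimum in one of these two, and dominance leaves one choice for each. *)
Lemma card_dominant_extensions (S : {set X}) (x0 : X) :
    x0 \in S -> dominant S -> #|S|.+1 = #|I| ->
    (forall a, exists y, forall i, i != a -> exists2 x, x \in S & k i x < k i y) ->
  #|[set x | x \notin S & dominant (x |: S)]| = 2.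
Proof.
move=> x0S /dominantP dS cardS extS.
pose mi i := [arg min_(x < x0 in S) k i x].
have miS i : mi i \in S by rewrite /mi; case: arg_minnP.
have mi_min i x : x \in S -> k i (mi i) <= k i x.
  by move=> xS; rewrite /mi; case: arg_minnP => // y _; apply.
have mi_surj x : x \in S -> exists i, mi i = x.
  move=> xS; have [i ki] := dS x; exists i; apply: (k_inj (i := i)).
  by apply/eqP; rewrite eqn_leq mi_min // ki.
have miT : mi @: setT = S.
  apply/setP => x; apply/imsetP/idP => [[i _ ->]//|/mi_surj[i <-]].
  by exists i.
have [a [b [ab mab]]] : exists a b, a != b /\ mi a = mi b.
  have : ~~ injectiveb mi.
    apply/negP => /injectiveP/card_imset inj_mi; move: (inj_mi setT).
    rewrite miT cardsT -cardS.
    by move/eqP; rewrite ltn_eqF.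
  by case/injectivePn => a [b ab mab]; exists a, b.
have inj_on u v : u != v -> mi u = mi v -> {in [set~ u] &, injective mi}.
  move=> uv muv; apply/imset_injP; rewrite cardsC1.
  suff -> : mi @: [set~ u] = S by rewrite -cardS.
  apply/setP => x; apply/imsetP/idP => [[i _ ->]//|/mi_surj[i <-]].
  have [->|iu] := eqVneq i u; last by exists i; rewrite ?inE.
  by exists v; rewrite ?inE // eq_sym.
have inja := inj_on _ _ ab mab.
have ba : b != a by rewrite eq_sym.
have injb := inj_on _ _ ba (esym mab).
(* [Y u] holds the points that can become a new minimum in the order [u] only; [y' u] will be the
   highest of them in that order. *)
pose Y u := [set y | [forall (i | i != u), k i (mi i) < k i y]].
have YP u y : reflect (forall i, i != u -> k i (mi i) < k i y) (y \in Y u).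
  by rewrite inE; apply: (iffP forall_inP).
have [y' Y'P] : exists y : I -> X, forall u, y u \in Y u /\
    forall z, z \in Y u -> k u z <= k u (y u).
  apply: (@fin_all_exists _ _ (fun u y => y \in Y u /\
    forall z, z \in Y u -> k u z <= k u y)) => u; have [y yP] := extS u.
  have yY : y \in Y u.
    by apply/YP => i /yP[x /(mi_min i)]; apply: leq_ltn_trans.
  by exists [arg max_(z > y in Y u) k u z]; case: arg_maxnP.
have YNS u v y : u != v -> mi u = mi v -> y \in Y u -> y \notin S.
  move=> uv muv /YP yY; apply/negP => /mi_surj[i iy].
  have [iu|/yY] := eqVneq i u; last by rewrite iy ltnn.
  by have := yY v; rewrite eq_sym uv -iy iu muv ltnn => /(_ isT).
have domY u v : u != v -> mi u = mi v -> dominant (y' u |: S).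
  move=> uv muv; have [/YP yY ymax] := Y'P u; apply/dominantP => z.
  have [zY|/YP zNY] := boolP (z \in Y u).
    exists u => x /setU1P[->|xS]; first exact: ymax.
    have [i ki] := dS z; have [iu|iu] := eqVneq i u; first by rewrite -iu ki.
    by move/YP: zY => /(_ _ iu); rewrite ltnNge ki.
  have [i iu] : exists2 i, i != u & k i z <= k i (mi i).
    have [/existsP[i /andP[iu ki]]|/existsPn nki] :=
      boolP [exists i, (i != u) && (k i z <= k i (mi i))]; first by exists i.
    by case: zNY => i iu; move: (nki i); rewrite iu -ltnNge.
  move=> kz; exists i => x /setU1P[->|xS].
    exact: leq_trans kz (ltnW (yY _ iu)).
  exact: leq_trans kz (mi_min _ _ xS).
(* A point of both [Y a] and [Y b] would lie above the minimum of [S] in every order, against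
   dominance. *)
have yab : y' a != y' b.
  apply/eqP => yE; have [i ki] := dS (y' a).
  have [ia|ia] := eqVneq i a.
    have [/YP/(_ i)] := Y'P b; rewrite -yE {1}ia ab => /(_ isT).
    by rewrite ltnNge ki.
  by have [/YP/(_ i ia)] := Y'P a; rewrite ltnNge ki.
suff -> : [set x | x \notin S & dominant (x |: S)] = [set y' a; y' b].
  by rewrite cards2 yab.
have sub u v x : u != v -> mi u = mi v -> {in [set~ u] &, injective mi} ->
    x \notin S -> dominant (x |: S) -> k v (mi v) <= k v x -> x = y' u.
  move=> uv muv inju xNS /dominantP dx kvx.
  have xY : x \in Y u.
    (* For [j] other than [v], dominance at [mi j] yields an order with the same minimum, and
       injectivity off [u] identifies it with [j]. *)
    apply/YP => j ju; have mjx i : mi i != x.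
      by apply: contra xNS => /eqP<-.
    rewrite ltn_neqAle (inj_eq (k_inj (i := j))) mjx /=.
    have [jv|jv] := eqVneq j v; first by rewrite jv.
    have [i ki] := dx (mi j).
    have mij : mi i = mi j.
      apply: (k_inj (i := i)); apply/eqP; rewrite eqn_leq mi_min //= ki //.
      by rewrite !inE miS orbT.
    have iu : i != u.
      apply: contra jv => /eqP iu; rewrite iu muv in mij.
      by apply/eqP/inju; rewrite ?inE // eq_sym.
    have -> : j = i by apply: inju; rewrite ?inE.
    by rewrite mij ki // !inE eqxx.
  have [/YP yY ymax] := Y'P u; apply: (k_inj (i := u)); apply/eqP.
  rewrite eqn_leq ymax //=; have [i ki] := dx (y' u).
  have [iu|iu] := eqVneq i u; first by rewrite iu in ki; rewrite ki // !inE eqxx.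
  have := yY i iu; rewrite ltnNge ki // !inE miS orbT //.
apply/setP => x; rewrite !inE; apply/andP/orP => [[xNS dx]|[]/eqP->]; first last.
- by rewrite (YNS b a) ?(domY b a) //; case: (Y'P b).
- by rewrite (YNS a b) ?(domY a b) //; case: (Y'P a).
move/dominantP: (dx) => /(_ (mi a))[i ki].
have mia : mi i = mi a.
  apply: (k_inj (i := i)); apply/eqP; rewrite eqn_leq mi_min //= ki //.
  by rewrite !inE miS orbT.
have kx : k i (mi a) <= k i x by rewrite ki // !inE eqxx.
have [ia|ia] := eqVneq i a.
  by rewrite ia in kx; right; apply/eqP; apply: (sub b a).
have ib : i = b by apply: inja; rewrite ?inE ?mia // eq_sym.
by rewrite ib mab in kx; left; apply/eqP; apply: (sub a b).
Qed.

(* Both sides count the incidences between rooms (dominant, of full size) and their faces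
   carrying exactly the labels other than i0. *)
Lemma door_room_count (c : X -> I) (i0 : I) :
  \sum_(S : {set X} | (#|S|.+1 == #|I|) && (c @: S == [set~ i0]))
     #|[set x | x \notin S & dominant (x |: S)]| =
  \sum_(S : {set X} | (#|S| == #|I|) && dominant S)
     #|[set x in S | c @: (S :\ x) == [set~ i0]]|.
Proof.
under eq_bigr do rewrite -sum1dep_card.
under [RHS]eq_bigr do rewrite -sum1dep_card.
rewrite !pair_big_dep /=.
rewrite (reindex_onto (fun p : {set X} * X => (p.1 :\ p.2, p.2))
   (fun p => (p.2 |: p.1, p.2))) => [|[S x] /= /andP[_ /andP[xS _]]]; last first.
  by rewrite setU1K.
apply: eq_bigl => -[S x] /=; rewrite !inE eqxx /= xpair_eqE eqxx andbT.
have [xS|xNS] := boolP (x \in S); last first.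
  rewrite andbF; apply/negP => /andP[_ /eqP SE]; move: xNS.
  by rewrite -SE !inE eqxx.
by rewrite setD1K // eqxx (cardsD1 x S) xS; case: dominant; case: (_ == #|I|);
  case: (_ == [set~ i0]).
Qed.

(** Without a rainbow room, every room has an even number of faces labelled by all but [i0]. Counted
    from the faces, [S0] contributes 1 and every other face 2, or 0 if it is not dominant, so the
    total is odd. *)
Lemma rainbow_room (c : X -> I) (i0 : I) (S0 : {set X}) :
    #|S0|.+1 = #|I| -> c @: S0 = [set~ i0] ->
    #|[set x | x \notin S0 & dominant (x |: S0)]| = 1 ->
    (forall S : {set X}, S != S0 -> #|S|.+1 = #|I| -> c @: S = [set~ i0] ->
      (exists x, x \in S) /\
      forall a, exists y, forall i, i != a -> exists2 x, x \in S & k i x < k i y) ->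
  exists S : {set X}, [/\ #|S| = #|I|, dominant S & c @: S = setT].
Proof.
move=> cardS0 cS0 ext1 ext2.
have [/existsP[S /and3P[/eqP ? ? /eqP ?]]|/existsPn noS] :=
  boolP [exists S : {set X}, [&& #|S| == #|I|, dominant S & c @: S == setT]].
  by exists S.
have := door_room_count c i0; move/(congr1 odd).
have /negPf-> : ~~ odd (\sum_(S : {set X} | (#|S| == #|I|) && dominant S)
    #|[set x in S | c @: (S :\ x) == [set~ i0]]|).
  apply: even_sum => S /andP[/eqP cardS domS].
  by rewrite odd_almost_rainbow //; move: (noS S); rewrite cardS eqxx domS.
rewrite (bigD1 S0) /= ?cardS0 ?cS0 ?eqxx // ext1 oddD.
rewrite (negPf (@even_sum _ _ _ _)) // => S /andP[/andP[/eqP cardS /eqP cS] SS0].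
have [domS|ndomS] := boolP (dominant S).
  by have [[x xS] extS] := ext2 S SS0 cardS cS; rewrite (card_dominant_extensions xS).
rewrite (_ : finset _ = set0) ?cards0 //; apply/setP => x; rewrite !inE.
by apply/negP => /andP[_ /(dominantS (subsetUr _ _))]; apply/negP.
Qed.
End Scarf.

(** * Scarf's lemma, by adding slack vertices *)

Section Slack.
Variables (T I : finType) (k : I -> T -> nat).
Hypothesis k_inj : forall i, injective (k i).

(* With slack vertices inr i, the pairs (S, C) of Scarf's lemma become the dominant sets
   S + {inr i | i not in C}, whose faces are obtained by removing one vertex. *)
Definition slack_key (i : I) (v : T + I) : nat :=
  match v with
  | inl t => (k i t).+1
  | inr j => if j == i then 0 else (\max_t k i t).+2 + enum_rank j
  end.

Lemma slack_key_inj i : injective (slack_key i).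
Proof.
have kmax t : k i t <= \max_t k i t by exact: leq_bigmax.
move=> [t|j] [u|l] /=.
- by move=> [] /k_inj ->.
- by case: ifP => // _ E; have := kmax t; lia.
- by case: ifP => // _ E; have := kmax u; lia.
- case: eqVneq => [->|_]; case: eqVneq => [->|_] //; try by move=> E; lia.
  by move=> E; congr inr; apply/enum_rank_inj/val_inj => /=; lia.
Qed.

(** The starting face consists of all slack vertices but [inr i0]. A slack vertex is lowest in its
    own order and above all points of [T] in the others, which gives both the unique extension of
    this face and the vertices needed to pivot at the other faces. *)
Lemma scarf (c : T -> I) (t0 : T) (i0 : I) :
  exists (S : {set T}) (C : {set I}),
    (forall y, exists2 i, i \in C & forall x, x \in S -> k i y <= k i x) /\
    C \subset c @: S.
Proof.
pose cc (v : T + I) := match v with inl t => c t | inr i => i end.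
have keylt i t : slack_key i (inr i) < slack_key i (inl t) by rewrite /= eqxx.
have keygt i j t : i != j -> slack_key i (inl t) < slack_key i (inr j).
  rewrite /= eq_sym => /negPf ->; have : k i t <= \max_t k i t by exact: leq_bigmax.
  by lia.
have inr_inj : injective (@inr T I) by move=> ? ? [].
pose S0 : {set T + I} := [set inr i | i in [set~ i0]].
have S0P i : (inr i \in S0) = (i != i0) by rewrite mem_imset ?inE.
have S0N t : inl t \notin S0 by apply/imsetP => -[].
have cardS0 : #|S0|.+1 = #|I|.
  rewrite card_imset // cardsC1; have : 0 < #|I| by apply/card_gt0P; exists i0.
  by lia.
have cS0 : cc @: S0 = [set~ i0].
  by rewrite -imset_comp (eq_imset (g := id)) ?imset_id.
have := rainbow_room slack_key_inj cardS0 cS0; case.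
(* Only the highest point in the order [i0] completes [S0]: dominance at [inl t1] can use no order
   whose slack vertex is in [S0]. *)
- pose t1 := [arg max_(t > t0) k i0 t].
  have t1P t : k i0 t <= k i0 t1 by rewrite /t1; case: arg_maxnP => // u _; apply.
  rewrite (_ : finset _ = [set inl t1]) ?cards1 //; apply/setP => -[t|i].
    rewrite !inE S0N /=; apply/dominantP/eqP => [dt|[->] v].
      have [i ki] := dt (inl t1); have ii0 : i = i0.
        apply/eqP; apply: contraT => ii0; have := keylt i t1.
        by rewrite ltnNge ki // !inE S0P ii0 orbT.
      congr inl; apply: (k_inj (i := i0)); apply/eqP; rewrite eqn_leq t1P /=.
      by have := ki (inl t); rewrite ii0 !inE eqxx => /(_ isT).
    case: v => [v|j].
      exists i0 => x /setU1P[->|/imsetP[j]]; first by rewrite /= ltnS t1P.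
      rewrite !inE => ji0 ->; apply/ltnW/keygt.
      by rewrite eq_sym.
    by exists j => x; rewrite /= eqxx.
  rewrite !inE S0P negbK; apply/negP => /andP[/eqP -> /dominantP/(_ (inl t0))[j kj]].
  have := keylt j t0; rewrite ltnNge kj // !inE S0P.
  by have [->|_] := eqVneq j i0; rewrite ?eqxx ?orbT.
- move=> S SS0 cardS cS.
  have [t tS] : exists t, inl t \in S.
    apply/existsP; apply: contraT => /existsPn Sinr; case/negP: SS0.
    rewrite eqEcard; move: cardS; rewrite -cardS0 => -[->]; rewrite leqnn andbT.
    apply/subsetP => -[t tS|i iS]; first by have := Sinr t; rewrite tS.
    have : i \in cc @: S by apply/imsetP; exists (inr i).
    by rewrite cS S0P !inE.
  split=> [|a]; first by exists (inl t).
  exists (inr a) => i ia; exists (inl t) => //; exact: keygt.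
move=> S [_ /dominantP domS cS].
(* An order whose slack vertex is in the room cannot serve for a point [y], and a label whose slack
   vertex is absent must come from a point of [T]. *)
exists [set t | inl t \in S], [set i | inr i \notin S]; split=> [y|].
  have [i ki] := domS (inl y); exists i => [|x]; rewrite inE.
    by apply/negP => /ki; rewrite leqNgt keylt.
  by move=> /ki.
apply/subsetP => i; rewrite inE => iS.
have /imsetP[[t|j] vS iE] : i \in cc @: S by rewrite cS inE.
  by rewrite iE; apply/imsetP; exists t; rewrite ?inE.
by rewrite iE vS in iS.
Qed.
End Slack.

(** * Hall's theorem with capacities *)

(** Induction on [#|D|]. If Hall's inequality is tight on a proper nonempty [K], then [K] and
    [D :\: K] are solved separately; if not, one element is placed anywhere allowed and the strict
    inequalities absorb the lost unit of capacity. *)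
Lemma hall_capacities (J I : finType) (r : J -> I -> bool) (i0 : I) (D : {set J})
    (a : I -> nat) :
    (forall K : {set J}, K \subset D ->
       #|K| <= \sum_(i | [exists j in K, r j i]) a i) ->
  exists s : J -> I, (forall j, j \in D -> r j (s j)) /\
    (forall i, #|[set j in D | s j == i]| <= a i).
Proof.
have [n] := ubnP #|D|; elim: n D a => // n IH D a; rewrite ltnS => leDn hallD.
have [->|[j0 j0D]] := set_0Vmem D.
  exists (fun=> i0); split=> [j|i]; first by rewrite inE.
  by rewrite (_ : finset _ = set0) ?cards0 //; apply/setP => j; rewrite !inE.
have [/existsP[K /and3P[/properP[KD [j1 j1D j1K]] K0 /eqP cardK]]|/existsPn tight] :=
  boolP [exists K : {set J}, [&& K \proper D, K != set0 &
     #|K| == \sum_(i | [exists j in K, r j i]) a i]].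
- have ltK : #|K| < #|D| by apply/proper_card/properP; split=> //; exists j1.
  have [s1 [rs1 cs1]] : exists s : J -> I, (forall j, j \in K -> r j (s j)) /\
      (forall i, #|[set j in K | s j == i]| <= a i).
    by apply: IH => [|L LK]; [lia|apply/hallD/(subset_trans LK)].
  (* A solution on the tight set [K] exhausts the capacity of all its neighbours. *)
  pose a' i := if [exists j in K, r j i] then 0 else a i.
  have [s2 [rs2 cs2]] : exists s : J -> I, (forall j, j \in D :\: K -> r j (s j)) /\
      (forall i, #|[set j in D :\: K | s j == i]| <= a' i).
    apply: IH => [|L LDK].
      rewrite (leq_trans _ leDn) // [ltnRHS](cardsD1 j0) j0D.
      have /set0Pn[j jK] := K0; have jD := subsetP KD _ jK.
      have : #|D :\: K| < #|D|.
        apply/proper_card/properP; split; first exact: subsetDl.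
        by exists j; rewrite // !inE jK.
      by rewrite (cardsD1 j0 D) j0D.
    have [LD LK] : L \subset D /\ [disjoint L & K].
      by move: LDK; rewrite subsetD => /andP.
    have := hallD (L :|: K); rewrite subUset LD KD cardsU (disjoint_setI0 LK) cards0 subn0.
    move=> /(_ isT); rewrite (bigID [pred i | [exists j in K, r j i]]) /=.
    rewrite (eq_bigl [pred i | [exists j in K, r j i]]) => [|i] /=; last first.
      apply/andP/idP => [[]//|Ki]; split=> //; have /exists_inP[j jK rj] := Ki.
      by apply/exists_inP; exists j; rewrite // inE jK orbT.
    rewrite -cardK addnC leq_add2l => /leq_trans; apply.
    rewrite big_mkcond [leqRHS]big_mkcond; apply: leq_sum => i _ /=; rewrite /a'.
    case: (boolP [exists j in K, r j i]) => Ki; first by rewrite andbF.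
    rewrite andbT; case: exists_inP => // -[j]; rewrite inE => /orP[jL rj|jK rj].
      by case: exists_inP => // -[]; exists j.
    by case/exists_inP: Ki; exists j.
  exists (fun j => if j \in K then s1 j else s2 j); split=> [j jD|i].
    by case: ifP => jK; [exact: rs1|apply: rs2; rewrite inE jK].
  have sub : [set j in D | (if j \in K then s1 j else s2 j) == i] \subset
     [set j in K | s1 j == i] :|: [set j in D :\: K | s2 j == i].
    by apply/subsetP => j; rewrite !inE; case: (j \in K) => /andP[-> ->].
  apply: leq_trans (subset_leq_card sub) _; rewrite cardsU.
  have := cs1 i; have := cs2 i; rewrite /a'; case: ifPn => Ki; first by lia.
  suff -> : [set j in K | s1 j == i] = set0 by rewrite cards0; lia.
  apply/setP => j; rewrite !inE; apply: contraNF Ki => /andP[jK /eqP <-].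
  by apply/exists_inP; exists j => //; apply: rs1.
have [i1 [ri1 ai1]] : exists i, r j0 i /\ 0 < a i.
  have := hallD [set j0]; rewrite sub1set j0D cards1 lt0n sum_nat_eq0 => /(_ isT).
  case/forall_inPn => i /exists_inP[j]; rewrite inE => /eqP -> ri; rewrite -lt0n.
  by exists i.
pose a' i := a i - (i == i1).
have [s [rs cs]] : exists s : J -> I, (forall j, j \in D :\ j0 -> r j (s j)) /\
    (forall i, #|[set j in D :\ j0 | s j == i]| <= a' i).
  apply: IH => [|K]; first by rewrite (cardsD1 j0 D) j0D in leDn.
  rewrite subsetD1 => /andP[KD j0K].
  have [->|K0] := eqVneq K set0; first by rewrite cards0.
  have KpD : K \proper D by apply/properP; split=> //; exists j0.
  have := hallD K KD; have := tight K; rewrite KpD K0 /= => ntK leK.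
  have {ntK leK} : #|K| < \sum_(i | [exists j in K, r j i]) a i.
    by rewrite ltn_neqAle ntK.
  suff : \sum_(i | [exists j in K, r j i]) a i <=
     \sum_(i | [exists j in K, r j i]) a' i + 1 by lia.
  apply: leq_trans (_ : \sum_(i | [exists j in K, r j i]) (a' i + (i == i1)) <= _).
    by apply: leq_sum => i _; rewrite /a'; lia.
  rewrite big_split leq_add2l /= big_mkcond (bigD1 i1) //= big1 => [|i /negPf->].
    by case: ifP; rewrite ?eqxx.
  by case: ifP.
exists (fun j => if j == j0 then i1 else s j); split=> [j jD|i].
  by have [->//|jj0] := eqVneq j j0; apply: rs; rewrite !inE jj0.
rewrite (cardsD1 j0) !inE eqxx j0D /=.
have := cs i; rewrite /a'; set A := #|_|; set B := #|_|.
suff -> : B = A by rewrite (eq_sym i1); case: eqVneq => [->|_]; lia.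
apply/eq_card => j; rewrite !inE; case: (eqVneq j j0) => //= _.
Qed.

(** * Scarf's lemma on grids of the simplex *)

(** The coordinatewise minima of [S], replaced by 0 outside [C], have sum at least $N-n$ by
    dominance. Hence [S] lies within [n.+1] of them in each coordinate: coordinates outside [C] are
    small, and each index in [C] labels a point of [S] near [s0]. *)
Lemma grid_rainbow (n N : nat) (c : {ffun 'I_n.+1 -> 'I_N.+1} -> 'I_n.+1) :
  exists2 x : {ffun 'I_n.+1 -> 'I_N.+1}, \sum_i x i = N &
    forall k, x k <= n.+1 \/
      exists z : {ffun 'I_n.+1 -> 'I_N.+1},
        [/\ \sum_i z i = N, c z = k & forall l, z l <= x l + n.+1 /\ x l <= z l + n.+1].
Proof.
pose T : finType := {x : {ffun 'I_n.+1 -> 'I_N.+1} | \sum_i (x i : nat) == N}.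
(* Order by the [i]-th coordinate, ties being broken by the rank in [T]. *)
pose key (i : 'I_n.+1) (x : T) := val x i * #|T| + enum_rank x.
have key_inj i : injective (key i).
  move=> x y /(congr1 (modn^~ #|T|)); rewrite /key !modnMDl !modn_small //.
  by move/val_inj/enum_rank_inj.
have key_le i (x y : T) : key i y <= key i x -> val y i <= val x i.
  rewrite leqNgt /key => le_key; rewrite leqNgt; apply: contra le_key => lt_xy.
  have /(leq_mul (leqnn #|T|)) := lt_xy; rewrite mulnC mulSn (mulnC #|T|).
  by have : enum_rank x < #|T| := ltn_ord _; lia.
pose f0 : {ffun 'I_n.+1 -> 'I_N.+1} := [ffun i => inord (if i == ord0 then N else 0)].
have f0P : \sum_i (f0 i : nat) == N.
  rewrite (bigD1 ord0) //= ffunE eqxx inordK // big1 ?addn0 // => i /negPf i0.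
  by rewrite ffunE i0 inordK.
pose t0 : T := exist (fun f : {ffun 'I_n.+1 -> 'I_N.+1} => \sum_i (f i : nat) == N) f0 f0P.
have [S [C [domS CS]]] := scarf key_inj (fun x : T => c (val x)) t0 ord0.
have [i1 i1C _] := domS t0.
have /imsetP[s0 s0S _] := subsetP CS _ i1C.
pose mu i := [arg min_(x < s0 in S) (val x i : nat)].
pose mm i := if i \in C then val (mu i) i : nat else 0.
have mmle i x : x \in S -> mm i <= val x i.
  rewrite /mm; case: ifP => // _ xS; rewrite /mu; case: arg_minnP => // y _; exact.
have sumx (x : T) : \sum_i val x i = N by apply/eqP/(valP x).
have lt_mm : N < \sum_i mm i + n.+1.
  rewrite ltnNge; apply/negP => leN.
  (* Otherwise some grid point exceeds every minimum over [C], against dominance; what remains of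
     the sum [N] goes to the coordinate [i1]. *)
  pose u i := if i \in C then (mm i).+1 else 0.
  have sumu : \sum_i u i <= N.
    apply: leq_trans leN; rewrite -[X in _ + X]muln1 -[X in X * 1]card_ord.
    rewrite -sum_nat_const -big_split /=; apply: leq_sum => i _.
    by rewrite /u; case: ifP => _; lia.
  pose v i := u i + (if i == i1 then N - \sum_i u i else 0).
  have sumv : \sum_i v i = N.
    have sum1 D : \sum_i (if i == i1 then D else 0) = D.
      by rewrite -big_mkcond (big_pred1 i1).
    by rewrite big_split /= sum1 subnKC.
  have vN i : v i < N.+1 by rewrite ltnS -sumv (bigD1 i) //= leq_addr.
  pose w : {ffun 'I_n.+1 -> 'I_N.+1} := [ffun i => inord (v i)].
  have wE i : w i = v i :> nat by rewrite ffunE inordK.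
  have wP : \sum_i (w i : nat) == N by under eq_bigr do rewrite wE; rewrite sumv.
  have [i iC /(_ (mu i))] :=
    domS (exist (fun f : {ffun 'I_n.+1 -> 'I_N.+1} => \sum_i (f i : nat) == N) w wP).
  have muS : mu i \in S by rewrite /mu; case: arg_minnP.
  have ui : u i = (val (mu i) i).+1 by rewrite /u /mm iC.
  by move=> /(_ muS)/key_le /=; rewrite wE /v ui leqNgt ltnS leq_addr.
have lexm x l : x \in S -> val x l <= mm l + n.+1.
  move=> xS; have := sumx x; rewrite (bigD1 l) //=.
  have : \sum_(i | i != l) mm i <= \sum_(i | i != l) val x i.
    by apply: leq_sum => i _; exact: mmle.
  by move: lt_mm; rewrite (bigD1 l) //=; lia.
exists (val s0) => [|i]; first exact: sumx.
have [iC|iC] := boolP (i \in C); last first.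
  by left; have := lexm s0 i s0S; rewrite /mm (negPf iC).
right; have /imsetP[z zS iE] := subsetP CS _ iC.
exists (val z); split=> // l.
split.
  by apply: leq_trans (lexm z l zS) _; rewrite leq_add2r mmle.
by apply: leq_trans (lexm s0 l s0S) _; rewrite leq_add2r mmle.
Qed.

From mathcomp Require Import all_classical all_reals all_analysis.
From mathcomp Require Import lra.
Import Order.TTheory GRing.Theory Num.Theory.
Import numFieldNormedType.Exports.
Local Open Scope classical_set_scope.
Local Open Scope ring_scope.

(** * Compactness of the simplex and passage to the limit *)

Lemma compact_seq_cluster (T : topologicalType) (K : set T) (u : nat -> T) :
    compact K -> (forall N, K (u N)) ->
  exists2 x, K x & forall U, nbhs x U -> forall N, exists2 M, (N <= M)%N & U (u M).
Proof.
move=> cK uK; have [|x [Kx clx]] := cK (u @ \oo) _.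
  by exists 0%N => // N _; exact: uK.
exists x => // U xU N.
have [|_ [[M NM <-] UM]] := clx [set u M | M in [set M | (N <= M)%N]] U _ xU.
  by exists N => // M NM; exists M.
by exists M.
Qed.

Lemma simplex_closed (R : realType) (n : nat) : closed (simplex R n).
Proof.
have -> : simplex R n = \bigcap_i [set t : 'rV[R]_n | 0 <= t ord0 i] `&`
    [set t : 'rV[R]_n | \sum_(i < n) t ord0 i = 1].
  by apply/seteqP; split=> [t [t0 t1]|t [t0 t1]]; split=> // i; [move=> _|]; exact: t0.
apply: closedI.
  apply: closed_bigI => i _.
  apply: (@closed_comp _ _ (fun t : 'rV[R]_n => t ord0 i) [set x | 0 <= x]).
    by move=> t _; exact: coord_continuous.
  exact: closed_ge.
apply: (@closed_comp _ _ (fun t : 'rV[R]_n => \sum_(i < n) t ord0 i) [set 1]).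
  move=> t _; apply: continuous_big => [|i _]; first exact: add_continuous.
  exact: coord_continuous.
exact: closed_eq.
Qed.

Lemma simplex_le1 (R : realType) (n : nat) (t : 'rV[R]_n) i :
  simplex R n t -> t ord0 i <= 1.
Proof.
by move=> [t0 <-]; rewrite (bigD1 i) //= lerDl sumr_ge0.
Qed.

Lemma simplex_compact (R : realType) (n : nat) : compact (simplex R n).
Proof.
have /(subclosed_compact (@simplex_closed R n)) :=
  @rV_compact R n (fun=> `[0, 1]%classic) (fun=> @segment_compact R 0 1).
apply=> t St i /=; rewrite in_itv /= (simplex_le1 i St) andbT.
by have [+ _] := St; apply.
Qed.

(** The function is the distance to [B]; for empty [B] that is infinite and the constant 1 replaces
    it. *)
Lemma closed_zero_set (R : realType) (V : normedModType R) (B : set V) :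
    closed B ->
  exists f : V -> R, [/\ continuous f, forall t, 0 <= f t & forall t, f t = 0 <-> B t].
Proof.
move=> cB; have [->|/set0P[b0 Bb0]] := eqVneq B set0.
  exists (fun=> 1); split=> // [t|t]; first exact: cvg_cst.
  by split=> // /eqP; rewrite oner_eq0.
have fin t : edist_inf B t \is a fin_num.
  rewrite ge0_fin_numE ?edist_inf_ge0 //; apply: le_lt_trans.
    by apply: ereal_inf_lbound; exists b0.
  rewrite -ge0_fin_numE ?edist_ge0 //; apply/edist_finP => /=.
  by exists (`|t - b0| + 1); rewrite ?ltr_wpDl //= -ball_normE /= ltrDl.
exists (fun t => fine (edist_inf B t)); split=> [t|t|t].
- by apply: fine_cvg; rewrite fineK //; exact: edist_inf_continuous.
- exact/fine_ge0/edist_inf_ge0.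
split=> [/eqP|Bt]; last by rewrite edist_inf0.
rewrite fine_eq0 // => /eqP d0; apply: contrapT => Bt.
have /nbhs_ballP[e /= e0 eB] : nbhs t (~` B).
  by apply: open_nbhs_nbhs; split => //; exact: closed_openC.
suff : (e%:E <= edist_inf B t)%E by rewrite d0 lee_fin leNgt e0.
apply: le_ereal_inf_tmp => _ [b Bb <-]; rewrite leNgt; apply/negP => /edist_lt_ball /= tb.
exact: eB tb Bb.
Qed.

Lemma simplex_rainbow_grid (R : realType) (n N : nat) (c : 'rV[R]_n.+1 -> 'I_n.+1) :
  exists2 y, simplex R n.+1 y & forall k, y ord0 k <= n.+1%:R / N.+1%:R \/
    exists z, [/\ simplex R n.+1 z, c z = k &
      forall l, `|z ord0 l - y ord0 l| <= n.+1%:R / N.+1%:R].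
Proof.
pose pt (x : {ffun 'I_n.+1 -> 'I_N.+2}) : 'rV[R]_n.+1 := \row_i ((x i)%:R / N.+1%:R).
have ptS (x : {ffun 'I_n.+1 -> 'I_N.+2}) : (\sum_i x i)%N = N.+1 -> simplex R n.+1 (pt x).
  move=> sx; split=> [i|]; first by rewrite mxE divr_ge0.
  under eq_bigr do rewrite mxE.
  by rewrite -mulr_suml -natr_sum sx divff // pnatr_eq0.
have N0 : 0 < N.+1%:R^-1 :> R by rewrite invr_gt0.
have [x sx xP] := grid_rainbow (fun x => c (pt x)).
exists (pt x) => [|k]; first exact: ptS.
have [xk|[z [sz cz zP]]] := xP k; [left|right].
  by rewrite mxE ler_pM2r // ler_nat.
exists (pt z); split=> [||l]; [exact: ptS|exact: cz|].
have [zx xz] := zP l.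
rewrite !mxE -mulrBl normrM (gtr0_norm N0) ler_pM2r // ler_norml.
by rewrite lerBlDl lerNl opprB lerBlDl -!natrD !ler_nat zx xz.
Qed.

(* A dual form of the Knaster-Kuratowski-Mazurkiewicz lemma: the labelling is arbitrary, and
   the boundary condition is on the indices required at x. *)
Lemma simplex_rainbow (R : realType) (n : nat) (c : 'rV[R]_n.+1 -> 'I_n.+1) :
  exists2 x, simplex R n.+1 x & forall i, 0 < x ord0 i ->
    closure [set y | simplex R n.+1 y /\ c y = i] x.
Proof.
pose y N := s2val (cid2 (simplex_rainbow_grid N c)).
have yS N : simplex R n.+1 (y N) by rewrite /y; case: cid2.
have yP N := s2valP' (cid2 (simplex_rainbow_grid N c)).
have [x Sx clx] := compact_seq_cluster (@simplex_compact R n.+1) yS.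
exists x => // i xi0 U /nbhs_ballP[e /= e0 eU].
(* The bound [x ord0 i / 2] excludes a small [i]-th coordinate of [y N]; [e / 2] allows for the two
   steps from [x] to [y N] to [z]. *)
pose d := Num.min (e / 2) (x ord0 i / 2).
have d0 : 0 < d by rewrite lt_min !divr_gt0.
have [N0 _ N0P] := near_infty_natSinv_lt (PosNum (divr_gt0 d0 (ltr0Sn R n))).
have [N /N0P /= Nd yNx] := clx _ (nbhsx_ballx x d d0) N0.
have {}Nd : n.+1%:R / N.+1%:R < d by rewrite mulrC -ltr_pdivlMr.
have yNl l : `|x ord0 l - y N ord0 l| < d by case: yNx => _; apply.
have [/le_lt_trans/(_ Nd) yd|[z [Sz cz zP]]] := yP N i.
  have := yNl i; rewrite ltr_norml; have : d <= x ord0 i / 2 by rewrite ge_min lexx orbT.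
  by lra.
exists z; split=> //; apply: eU; split=> // j l; rewrite ord1.
rewrite /ball /= -(subrKA (y N ord0 l)) (le_lt_trans (ler_normD _ _)) //.
have dE : d <= e / 2 by rewrite ge_min lexx.
rewrite [e]splitr ltrD // ?(lt_le_trans (yNl l)) // distrC.
exact: le_lt_trans (zP l) (lt_le_trans Nd dE).
Qed.

(** * From weights to transversals *)

(** Double counting gives Hall's condition: the columns in [K] have total weight [#|K|], carried by
    the rows positive somewhere on [K], each of weight at most [a i]. *)
Lemma column_stochastic_assignment (R : realDomainType) (n m : nat)
    (w : 'I_n.+1 -> 'I_m -> R) (a : 'I_n.+1 -> nat) :
    (forall i j, 0 <= w i j) -> (forall j, \sum_i w i j = 1) ->
    (forall i, \sum_j w i j <= (a i)%:R) -> (\sum_i a i = m)%N ->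
  exists s : 'I_m -> 'I_n.+1, (forall i, #|[pred j | s j == i]| = a i) /\
    forall j, 0 < w (s j) j.
Proof.
move=> w0 w1 wa sum_a.
have [|s [ws sa]] := @hall_capacities _ _ (fun j i => 0 < w i j) ord0 [set: 'I_m]%SET a.
  move=> K _; rewrite -(ler_nat R) natr_sum -sum1_card natr_sum.
  rewrite (eq_bigr (fun j => \sum_i w i j)) => [|j _]; last by rewrite w1.
  rewrite exchange_big /= (bigID [pred i | [exists j in K, 0 < w i j]]) /=.
  rewrite [X in _ + X]big1 ?addr0 => [|i Ki].
    apply: ler_sum => i _; apply: le_trans (wa i).
    by rewrite [leRHS](bigID [in K]) /= lerDl sumr_ge0.
  apply: big1 => j jK; apply/eqP; rewrite eq_le w0 andbT leNgt.
  by apply: contra Ki => wij; apply/exists_inP; exists j.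
have sa' i : (#|[pred j | s j == i]| <= a i)%N.
  apply: leq_trans (sa i); apply/subset_leq_card/fintype.subsetP => j.
  by rewrite !inE.
exists s; split=> [i|j]; last by apply: ws; rewrite inE.
have sum_s : (\sum_i #|[pred j | s j == i]| = m)%N.
  under eq_bigr do rewrite -sum1_card.
  rewrite -[RHS]card_ord -sum1_card.
  by rewrite (partition_big s xpredT).
(* Both sums equal [m], so no capacity is left over. *)
have : (\sum_i a i <= \sum_i #|[pred j | s j == i]|)%N by rewrite sum_s sum_a.
rewrite (bigD1 i) //= [leqRHS](bigD1 i) //= => le_sum.
have le_rest : (\sum_(j | j != i) #|[pred l | s l == j]| <= \sum_(j | j != i) a j)%N.
  by apply: leq_sum.
have := leq_trans le_sum (leq_add (leqnn _) le_rest); rewrite leq_add2r => ge_a.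
by apply/eqP; rewrite eqn_leq sa'.
Qed.

Lemma continuous_sum_at (R : realType) (T : topologicalType) (J : finType) (f : J -> T -> R) x :
  (forall j, {for x, continuous (f j)}) -> {for x, continuous (fun t => \sum_j f j t)}.
Proof.
move=> fc; rewrite /prop_for /continuous_at.
by apply: cvg_big => [|i _]; [exact: add_continuous|exact: fc].
Qed.

(** Normalising by column sums gives the partitions of unity [w], of total weight [m], so some row
    sum is at most [a i]. At the point [x], a row with [x ord0 i = 0] vanishes; any other row
    inherits its bound by continuity from points labelled [i] close to [x]. *)
Lemma positive_transversal (R : realType) (n m : nat)
    (f : 'I_n.+1 -> 'I_m -> 'rV[R]_n.+1 -> R) (a : 'I_n.+1 -> nat) :
    (forall i j, continuous (f i j)) ->
    (forall i j t, simplex R n.+1 t -> 0 <= f i j t) ->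
    (forall i j t, facet R n.+1 i t -> f i j t = 0) ->
    (forall j t, simplex R n.+1 t -> exists i, 0 < f i j t) ->
    (\sum_i a i = m)%N ->
  exists (s : 'I_m -> 'I_n.+1) (t : 'rV[R]_n.+1),
    [/\ simplex R n.+1 t, forall i, #|[pred j | s j == i]| = a i &
      forall j, 0 < f (s j) j t].
Proof.
move=> fc f0 ffacet fpos sum_a.
pose g j t := \sum_i f i j t; pose w t i j := f i j t / g j t.
have g0 j t : simplex R n.+1 t -> 0 < g j t.
  move=> St; have [i fi] := fpos j t St; rewrite /g (bigD1 i) //= ltr_wpDr //.
  by apply: sumr_ge0 => l _; exact: f0.
have w0 t i j : simplex R n.+1 t -> 0 <= w t i j.
  by move=> St; rewrite divr_ge0 ?f0 // ltW ?g0.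
have w1 t j : simplex R n.+1 t -> \sum_i w t i j = 1.
  by move=> St; rewrite -mulr_suml divff // gt_eqF ?g0.
have small t : simplex R n.+1 t -> exists i, \sum_j w t i j <= (a i)%:R.
  move=> St; apply/existsP; apply: contraT; rewrite negb_exists => /forallP large.
  have : \sum_i (a i)%:R < \sum_i \sum_j w t i j.
    by apply: ltr_sum => [|i _]; [by apply/hasP; exists ord0|by rewrite ltNge large].
  rewrite exchange_big /= [ltRHS](eq_bigr (fun=> 1)) => [|j _]; last exact: w1.
  by rewrite -natr_sum sum_a sumr_const card_ord ltxx.
(* The default [ord0] can only be taken outside the simplex. *)
pose c t := odflt ord0 [pick i | \sum_j w t i j <= (a i)%:R].
have cP t : simplex R n.+1 t -> \sum_j w t (c t) j <= (a (c t))%:R.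
  rewrite /c => /small[i it]; case: pickP => //= /(_ i).
  by rewrite it.
have [x Sx clx] := simplex_rainbow c.
have wx i : \sum_j w x i j <= (a i)%:R.
  have [x0 _] := Sx; have := x0 i; rewrite le_eqVlt => /orP[/eqP xi|/clx cli].
    by rewrite big1 // => j _; rewrite /w ffacet ?mul0r //; split=> //; rewrite -xi.
  rewrite leNgt; apply/negP => gt_a.
  have wc : {for x, continuous (fun t => \sum_j w t i j)}.
    apply: continuous_sum_at => j; apply: cvgM; [exact: nbhs_filter|exact: fc|].
    apply: cvgV; [exact: nbhs_filter|by rewrite gt_eqF ?g0|].
    by apply: continuous_sum_at => l; exact: fc.
  have [t [[St ct] /=]] := cli _ (cvgr_gt _ wc _ gt_a).
  by rewrite ltNge -ct cP.
have [s [cards ws]] := column_stochastic_assignment (fun i j => w0 x i j Sx)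
  (fun j => w1 x j Sx) wx sum_a.
exists s, x; split=> // j.
by have := ws j; rewrite /w pmulr_lgt0 // invr_gt0 g0.
Qed.

(** * Functions adapted to open and to closed coverings *)

Section Covers.
Variables (R : realType) (n m : nat) (A : 'I_n.+1 -> 'I_m -> set 'rV[R]_n.+1).
Hypothesis A_sub : forall i j, A i j `<=` simplex R n.+1.
Hypothesis A_facet : forall i j, A i j `&` facet R n.+1 i = set0.
Hypothesis A_cover : forall j, \bigcup_(i in [set: 'I_n.+1]) A i j = simplex R n.+1.
Variables (a : 'I_n.+1 -> nat) (a_sum : (\sum_i a i = m)%N).

(** [closed_zero_set], applied to the complement of an open set with trace [A i j], gives a function
    that on the simplex is positive exactly on [A i j]. *)
Lemma open_covers_transversal : (forall i j, open_in (simplex R n.+1) (A i j)) ->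
  exists (s : 'I_m -> 'I_n.+1) (t : 'rV[R]_n.+1),
    (forall i, #|[pred j | s j == i]| = a i) /\ forall j, A (s j) j t.
Proof.
move=> A_open.
have U_ex i j : exists f : 'rV[R]_n.+1 -> R, [/\ continuous f, forall t, 0 <= f t &
    forall t, simplex R n.+1 t -> f t = 0 <-> ~ A i j t].
  have /open_subspaceP[U oU UA] := A_open i j.
  have [f [fc f0 fP]] := closed_zero_set (open_closedC oU).
  exists f; split=> // t St; apply: iff_trans (fP t) _.
  have UAt : U t <-> A i j t.
    have := congr1 (fun B => B t) UA; rewrite /= => UAt.
    split=> [Ut|At].
      by have : (U `&` simplex R n.+1) t by []; rewrite UA => -[].
    by have : (A i j `&` simplex R n.+1) t by []; rewrite -UA => -[].
  by rewrite /setC /= (propext UAt).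
pose f i j := sval (cid (U_ex i j)).
have fP i j := svalP (cid (U_ex i j)).
have f_gt0 i j t : simplex R n.+1 t -> (0 < f i j t) <-> A i j t.
  have [_ f0 fA] := fP i j; move=> St; rewrite lt_neqAle f0 andbT eq_sym.
  split=> [/eqP nf|At]; first by apply: contrapT => /(fA t St).
  by apply/eqP => /(fA t St).
have [|||||s [t [St cards ft]]] := @positive_transversal R n m f a.
- by move=> i j; have [] := fP i j.
- by move=> i j t _; have [_ f0 _] := fP i j; exact: f0.
- move=> i j t [St ti]; have [_ _ fA] := fP i j; apply/(fA t St) => At.
  by have : set0 t by rewrite -(A_facet i j).
- move=> j t St; have : (\bigcup_(i in [set: 'I_n.+1]) A i j) t by rewrite A_cover.
  by move=> [i _ At]; exists i; apply/f_gt0.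
- exact: a_sum.
by exists s, t; split=> // j; apply/f_gt0.
Qed.

(** By contradiction: otherwise, for each admissible [s], the sum [h s] of the distances to the sets
    [A (s j) j] has a positive minimum on the compact simplex. With [e] at most all of these
    finitely many minima, the positive case yields a point at distance below [e / m%:R] from each
    set, so [h s] drops below [e]. *)
Lemma closed_covers_transversal : (0 < m)%N -> (forall i j, closed_in (simplex R n.+1) (A i j)) ->
  exists (s : 'I_m -> 'I_n.+1) (t : 'rV[R]_n.+1),
    (forall i, #|[pred j | s j == i]| = a i) /\ forall j, A (s j) j t.
Proof.
move=> m_gt0 A_closed.
have A_cl i j : closed (A i j).
  have /closed_subspaceP[V cV VA] := A_closed i j.
  suff -> : A i j = V `&` simplex R n.+1 by apply: closedI => //; exact: simplex_closed.
  by rewrite VA; apply/esym/setIidPl/A_sub.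
pose d i j := sval (cid (closed_zero_set (A_cl i j))).
have dP i j := svalP (cid (closed_zero_set (A_cl i j))).
have dc i j : continuous (d i j) by have [] := dP i j.
have d0 i j t : 0 <= d i j t by have [_ d0 _] := dP i j; exact: d0.
have dA i j t : d i j t = 0 <-> A i j t by have [_ _] := dP i j; exact.
pose h (s : {ffun 'I_m -> 'I_n.+1}) t := \sum_j d (s j) j t.
have h0 s t : 0 <= h s t by apply: sumr_ge0.
have S0 : simplex R n.+1 !=set0 by have [x Sx _] := @simplex_rainbow R n (fun=> ord0); exists x.
have hmin s : exists2 t, t \in simplex R n.+1 &
    forall u, u \in simplex R n.+1 -> h s t <= h s u.
  apply: compact_EVT_min => //; first exact: simplex_compact.
  apply: continuous_subspaceT => t; apply: continuous_sum_at => j; exact: dc.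
pose tm s := s2val (cid2 (hmin s)).
have tmP s u : simplex R n.+1 u -> h s (tm s) <= h s u.
  by move=> Su; apply: (s2valP' (cid2 (hmin s))); rewrite inE.
apply: contrapT => none.
pose good (s : {ffun 'I_m -> 'I_n.+1}) := [forall i, #|[pred j | s j == i]| == a i].
have h_gt0 s : good s -> 0 < h s (tm s).
  move=> /forallP gs; rewrite lt_neqAle h0 andbT eq_sym; apply/eqP => hs0.
  apply: none; exists s, (tm s); split=> [i|j]; first exact/eqP/gs.
  by apply/dA; move/psumr_eq0P: hs0; apply.
pose e := \big[Num.min/1]_(s | good s) h s (tm s).
have e0 : 0 < e by apply/lt_bigmin.
(* The factor [t ord0 i] forces vanishing on the facet, which the neighbourhood of [A i j] may meet;
   on [A i j] itself it is positive. *)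
pose f i j (t : 'rV[R]_n.+1) := t ord0 i * Num.max 0 (e / m%:R - d i j t).
have em : 0 < e / m%:R by rewrite divr_gt0 // ltr0n.
have [|||||s [t [St cards ft]]] := @positive_transversal R n m f a.
- move=> i j t; apply: cvgM; [exact: nbhs_filter|exact: coord_continuous|].
  apply: (@continuous_max _ _ (fun=> 0) (fun u => e / m%:R - d i j u)).
    by apply: cvg_cst; exact: nbhs_filter.
  by apply: cvgB; [exact: nbhs_filter|apply: cvg_cst; exact: nbhs_filter|exact: dc].
- by move=> i j t [t0 _]; rewrite mulr_ge0 // le_max lexx.
- by move=> i j t [_ ti]; rewrite /f ti mul0r.
- move=> j t St; have : (\bigcup_(i in [set: 'I_n.+1]) A i j) t by rewrite A_cover.
  move=> [i _ At]; exists i; rewrite /f (iffRL (dA i j t) At) subr0.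
  rewrite mulr_gt0 // ?lt_max ?em ?orbT // lt_neqAle; have [-> _] := St.
  rewrite andbT eq_sym; apply/eqP => ti.
  by have : set0 t by rewrite -(A_facet i j).
- exact: a_sum.
pose s' := [ffun j => s j].
have gs : good s'.
  apply/forallP => i; rewrite -(cards i); apply/eqP/eq_card => j.
  by rewrite !inE ffunE.
have : h s' t < e.
  have -> : e = \sum_(j < m) e / m%:R.
    by rewrite sumr_const card_ord -[RHS]mulr_natr divfK // pnatr_eq0 -lt0n.
  apply: ltr_sum => [|j _]; first by apply/hasP; exists (Ordinal m_gt0).
  have := ft j; rewrite ffunE /f ltNge => ftj; rewrite ltNge; apply: contra ftj => ed.
  by rewrite max_l ?mulr0 // subr_le0.
by apply/negP; rewrite -leNgt; apply: le_trans (bigmin_le_cond 1 _ gs) _; exact: tmP.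
Qed.

End Covers.

Theorem corollary2 (R : realType) (n m : nat) (n_gt0 : (0 < n)%N)
  (m_gt0 : (0 < m)%N)
  (A : 'I_n -> 'I_m -> set 'rV[R]_n)
  (A_sub : forall i j, A i j `<=` simplex R n)
  (A_open_or_closed :
    (forall i j, open_in (simplex R n) (A i j)) \/
    (forall i j, closed_in (simplex R n) (A i j)))
  (A_facet : forall i j, A i j `&` facet R n i = set0)
  (A_cover : forall j, \bigcup_(i in [set: 'I_n]) A i j = simplex R n)
  (a : 'I_n -> nat) (a_gt0 : forall i, (0 < a i)%N)
  (a_sum : (\sum_(i < n) a i = m)%N) :
  exists sigma : 'I_m -> 'I_n,
    (forall i, #|[pred j | sigma j == i]| = a i) /\
    \bigcap_(j in [set: 'I_m]) A (sigma j) j !=set0.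
Proof.
case: n => [//|n] in n_gt0 A A_sub A_open_or_closed A_facet A_cover a a_gt0 a_sum *.
have [s [t [cards At]]] : exists (s : 'I_m -> 'I_n.+1) (t : 'rV[R]_n.+1),
    (forall i, #|[pred j | s j == i]| = a i) /\ forall j, A (s j) j t.
  by case: A_open_or_closed => ?; [exact: open_covers_transversal|exact: closed_covers_transversal].
by exists s; split=> //; exists t => j _.
Qed.
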